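(* Let $x_n := \left\{ \frac{\log(2n-1)}{\log(2)} \right\}$ for $n = 1,2,\ldots$. For $0 \le \alpha \le 1$, $N \in \mathbb{N}$ and $s \ge 0$ let $$F_{N}^\alpha (s) := \frac{1}{N^{2-\alpha}} \# \left\{ 1 \leq k \neq l \leq N \ : \ \left\| x_k - x_l\right\| \leq \frac{s}{N^\alpha} \right\}.$$ Then $F_N^\alpha(s)$ has the lower bound $$g(N,s,\alpha) = 4 \frac{K_{\max}(N,s,\alpha)}{N^{1-\alpha}} - 2 \frac{K_{\min}(N,s,\alpha)}{N^{1-\alpha}} - \frac{2}{N^{2-\alpha}} - \tilde{K}(N,s,\alpha) \cdot \frac{C_{N,s,\alpha} + 1}{C_{N,s,\alpha} N^{2-\alpha}},$$ and for any $\alpha < 1$ (within the range $0 \le \alpha \le 1$), $$\lim_{N \to \infty} g(N,s,\alpha) = 2s \cdot \frac{3}{4} \log(4),$$ which is independent of $\alpha$ (only the speed of convergence is the faster, the smaller $\alpha$ is). The sequence $(x_n)_{n\in\mathbb{N}}$ does not have weak correlations for any $0 \le \alpha \le 1$.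
   Context: Here $\log$ is the natural logarithm, $\{\cdot\}$ denotes the fractional part of a real number, and $\|\cdot\|$ denotes the distance of a real number from its nearest integer. The function $F_N^\alpha$ is called the weak (or $\alpha$-) pair correlation function of the sequence; a sequence is said to have weak correlations (for the parameter $\alpha$) if $\lim_{N\to\infty} F_N^\alpha(s) = 2s$ for all $s \ge 0$. The quantities in $g$ are $$C_{N,s,\alpha} = 2^{s/N^\alpha} - 1,\qquad K_{\max}(N,s,\alpha) = \left\lfloor \frac{2N C_{N,s,\alpha}}{1+C_{N,s,\alpha}} \right\rfloor,\qquad K_{\min}(N,s,\alpha) = \left\lfloor N C_{N,s,\alpha} \right\rfloor,$$ $$\tilde{K}(N,s,\alpha) = K_{\max}(N,s,\alpha)\big(K_{\max}(N,s,\alpha)+1\big) - K_{\min}(N,s,\alpha)\big(K_{\min}(N,s,\alpha)+1\big).$$ The numbers $K_{\max}(N,s,\alpha)$ and $K_{\min}(N,s,\alpha)$ play the role of the maximum and minimum number of points among $x_1,\ldots,x_N$ lying to the right of a given point at distance at most $s/N^\alpha$.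
   Formalization: The lower bound is stated only for s/N^α ≤ 1/2 (it fails e.g. at s = N^α, N ≥ 2), and the limit of g only for 0 < α < 1 (at α = 0, s = 1 it is 2, not (3/2)log 4); the parenthetical remark on the speed of convergence is omitted. *)

(* Defs.v *)
From HB Require Import structures.
From mathcomp Require Import all_boot all_order all_algebra.
From mathcomp Require Import all_classical all_reals all_analysis.

Set Implicit Arguments.
Unset Strict Implicit.
Unset Printing Implicit Defensive.

Import Order.TTheory GRing.Theory Num.Theory.
Import numFieldNormedType.Exports.

Local Open Scope classical_set_scope.
Local Open Scope ring_scope.

Definition frac_part (R : realType) (y : R) : R := y - (Num.floor y)%:~R.

(* ||y||; the infimum over the integers is attained at a nearest integer. *)
Definition dist_int (R : realType) (y : R) : R :=
  inf [set `|y - n%:~R| | n in [set: int]].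

(* Sequences are indexed from 1: the value at 0 is junk and never used. *)
Definition log_odd_seq (R : realType) (n : nat) : R :=
  frac_part (ln (2 * n%:R - 1) / ln 2).

(* F_N^alpha(s).  A pair (i, j) of 'I_N * 'I_N stands for the pair of
   indices (k, l) = (i + 1, j + 1) of {1, ..., N}^2. *)
Definition pair_corr (R : realType) (x : nat -> R) (N : nat) (alpha s : R) : R :=
  (#|[set p : 'I_N * 'I_N | (p.1 != p.2) &&
       (dist_int (x p.1.+1 - x p.2.+1) <= s / N%:R `^ alpha)%R]%SET|)%:R
  / N%:R `^ (2 - alpha).

Definition weak_correlations (R : realType) (x : nat -> R) (alpha : R) : Prop :=
  forall s : R, 0 <= s -> (fun N => pair_corr x N alpha s) @ \oo --> 2 * s.

Definition C_ (R : realType) (N : nat) (s alpha : R) : R :=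
  2 `^ (s / N%:R `^ alpha) - 1.

Definition K_max (R : realType) (N : nat) (s alpha : R) : R :=
  (Num.floor (2 * N%:R * C_ N s alpha / (1 + C_ N s alpha)))%:~R.

Definition K_min (R : realType) (N : nat) (s alpha : R) : R :=
  (Num.floor (N%:R * C_ N s alpha))%:~R.

Definition K_tilde (R : realType) (N : nat) (s alpha : R) : R :=
  K_max N s alpha * (K_max N s alpha + 1)
  - K_min N s alpha * (K_min N s alpha + 1).

(* For s = 0 we have C_ = 0 and the last fraction is 0 / 0 in the formula; here
   it is multiplied by K_tilde = 0, so the whole term is 0. *)
Definition g_bound (R : realType) (N : nat) (s alpha : R) : R :=
  4 * (K_max N s alpha / N%:R `^ (1 - alpha))
  - 2 * (K_min N s alpha / N%:R `^ (1 - alpha))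
  - 2 / N%:R `^ (2 - alpha)
  - K_tilde N s alpha
    * ((C_ N s alpha + 1) / (C_ N s alpha * N%:R `^ (2 - alpha))).

(* Main.v *)
Require Import Defs.
From HB Require Import structures.
From mathcomp Require Import all_boot all_order all_algebra.
From mathcomp Require Import all_classical all_reals all_analysis.
From mathcomp Require Import ring lra zify.

Import Order.TTheory GRing.Theory Num.Theory.
Import numFieldNormedType.Exports.

Local Open Scope classical_set_scope.
Local Open Scope ring_scope.

(** The odd numbers 1, 3, ..., 2N-1 multiplied by suitable powers of 2 are
    exactly the integers of [N, 2N), so modulo 1 the points x_1, ..., x_N are
    log2 a with N <= a < 2N.  Put d = s / N^alpha and C = 2^d - 1.  The i-th
    point to the right of log2 a lies within d of it for every a as soon as
    i <= N C, and otherwise at least when i / C <= a <= 2N - i; summing over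
    i <= K_max and counting every pair in both orders gives g.  Since
    C N^alpha tends to s ln 2, the limit of g is 3 s ln 2, and g is at least
    3 s ln 2 (1 - C) - 10 N^(alpha-1) when C <= 1.  As 3 ln 2 > 2, this is
    incompatible with the limit 2 s: take s large if alpha > 0, and s small
    if alpha = 0. *)

(** * Odd parts of integers and the points of the sequence modulo 1 *)

(** Zero-based, to match ordinals: the odd part of [a] is [2 n - 1] with [n = (odd_index a).+1]. *)
Definition odd_index (a : nat) : nat := (a`_2^')%N./2.

Lemma odd_indexK (a : nat) : (odd_index a).*2.+1 = (a`_2^')%N.
Proof.
by rewrite -[RHS]odd_double_half odd_2'nat part_pnat add1n.
Qed.

Lemma odd_index_ltn (N a : nat) : (0 < a < N.*2)%N -> (odd_index a < N)%N.
Proof.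
case/andP=> a0 aN; have := odd_indexK a; have := dvdn_leq a0 (dvdn_part (2^')%N a).
lia.
Qed.

(** If two distinct positive integers have the same odd part, one is at least twice the other, which
    is impossible inside [[N, 2N)]. *)
Lemma odd_index_inj (N a b : nat) : (0 < N)%N ->
  (N <= a < N.*2)%N -> (N <= b < N.*2)%N -> odd_index a = odd_index b -> a = b.
Proof.
move=> N0; wlog le_lg : a b / (logn 2 a <= logn 2 b)%N => [hw aN bN ab|].
  by case/orP: (leq_total (logn 2 a) (logn 2 b)) => le_lg;
    [exact: hw | apply/esym/hw].
move=> aN bN ab.
have a0 : (0 < a)%N by lia.
have b0 : (0 < b)%N by lia.
have oab : (a`_2^' = b`_2^')%N by rewrite -!odd_indexK ab.
have := partnC 2%N a0; have := partnC 2%N b0; rewrite !p_part -oab => eb ea.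
move: le_lg; rewrite leq_eqVlt => /orP[/eqP elg|lt_lg]; first by rewrite -ea -eb elg.
have := leq_pexp2l (isT : (0 < 2)%N) lt_lg; rewrite expnS => le2.
have := leq_mul le2 (leqnn (a`_2^')%N); rewrite -mulnA ea eb; lia.
Qed.

Lemma log_odd_seq_odd_index {R : realType} (a : nat) : (0 < a)%N ->
  exists m : int,
    log_odd_seq R (odd_index a).+1 = ln (a%:R : R) / ln 2 + m%:~R.
Proof.
move=> a0; rewrite /log_odd_seq /frac_part.
set y := ln _ / ln 2; exists (- (logn 2 a)%:Z - Num.floor y).
have ln2 : ln 2 != 0 :> R by rewrite gt_eqF// ln_gt0// ltr1n.
have -> : ln (a%:R : R) / ln 2 = (logn 2 a)%:R + y; last by ring.
rewrite -{1}(partnC 2%N a0) p_part -odd_indexK natrM lnM ?posrE ?ltr0n ?expn_gt0//.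
rewrite natrX lnXn ?ltr0n// mulrDl mulrnAl divff// /y.
by congr (_ + ln _ / _); rewrite -addn1 -muln2 natrD natrM !mulrS; ring.
Qed.

Lemma dist_int_le {R : realType} (y : R) (n : int) : dist_int y <= `|y - n%:~R|.
Proof.
apply: ge_inf; last by exists n.
by exists 0 => _ [m _ <-].
Qed.

Lemma dist_log_odd_seq_le {R : realType} (a b : nat) (d : R) (n : int) :
  (0 < a)%N -> (0 < b)%N ->
  `|ln (a%:R : R) - ln b%:R - n%:~R * ln 2| <= d * ln 2 ->
  dist_int (log_odd_seq R (odd_index a).+1 - log_odd_seq R (odd_index b).+1) <= d.
Proof.
move=> a0 b0; have l2 : 0 < ln 2 :> R by rewrite ln_gt0// ltr1n.
have [ma ->] := @log_odd_seq_odd_index R _ a0.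
have [mb ->] := @log_odd_seq_odd_index R _ b0 => h.
(* The integers [ma] and [mb] by which the points differ from [log2 a] and [log2 b] are absorbed
   into [n]. *)
apply: (le_trans (dist_int_le _ (n + ma - mb))).
rewrite -(ler_pM2r l2) (le_trans _ h)// le_eqVlt; apply/orP; left; apply/eqP.
rewrite -[X in _ * X](gtr0_norm l2) -normrM; congr (`|_|); rewrite !intrD intrN; field.
by rewrite gt_eqF.
Qed.

(** * Arcs between points, and their asymmetry *)

(* With [a = N + u] and [b = N + v], the arc of the circle R/Z going right
   from log2 a to log2 b has length at most log2 q; the factor 2 accounts for
   the passage through 2N, which is identified with N. *)
Definition log_arc {R : realType} (q : R) (N u v : nat) : bool :=
  (u != v) &&
  ((if (u < v)%N then 1 else 2) * (N + v)%:R <= q * (N + u)%:R).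

Lemma log_arc_dist {R : realType} (d : R) (N u v : nat) :
  (u < N)%N -> (v < N)%N -> log_arc (2 `^ d) N u v ->
  dist_int (log_odd_seq R (odd_index (N + u)).+1
            - log_odd_seq R (odd_index (N + v)).+1) <= d /\
  dist_int (log_odd_seq R (odd_index (N + v)).+1
            - log_odd_seq R (odd_index (N + u)).+1) <= d.
Proof.
move=> uN vN /andP[uv].
have a0 : (0 < N + u)%N by lia.
have b0 : (0 < N + v)%N by lia.
(* [w] is the factor in [log_arc] and [n = log2 w]. Since [N + u <= w * (N + v)], the arc has
   nonnegative length, so bounding it by [d] bounds its absolute value. *)
have [w w0 [n [lnw wab]]] : exists2 w : nat, (0 < w)%N & exists n : int,
    ln (w%:R : R) = n%:~R * ln 2 /\
    ((N + u <= w * (N + v))%N /\ w = if (u < v)%N then 1%N else 2%N).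
  case: ifP => huv; [exists 1%N => //; exists 0 | exists 2%N => //; exists 1].
    by rewrite ln1 mul0r; split=> //; split=> //; lia.
  by rewrite mul1r; split=> //; split=> //; lia.
have -> : (if (u < v)%N then 1 else 2) = w%:R :> R by case: wab => _ ->; case: ifP.
case: wab => wab _ h.
have h1 : ln (w%:R : R) + ln (N + v)%:R <= d * ln 2 + ln (N + u)%:R.
  rewrite -lnM ?posrE ?ltr0n// -ln_powR -lnM ?posrE ?ltr0n ?powR_gt0//.
  by rewrite ler_ln// posrE ?mulr_gt0 ?ltr0n ?powR_gt0.
have h2 : ln (N + u)%:R <= ln (w%:R : R) + ln (N + v)%:R.
  by rewrite -lnM ?posrE ?ltr0n// -natrM ler_ln ?posrE ?ltr0n ?ler_nat ?muln_gt0 ?w0.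
rewrite lnw in h1 h2.
split; [apply: (dist_log_odd_seq_le _ _ _ n)|apply: (dist_log_odd_seq_le _ _ _ (- n))] => //.
  by rewrite ler_norml; apply/andP; split; lra.
by rewrite intrN ler_norml; apply/andP; split; lra.
Qed.

(** The 2-adic valuation is even on the left and odd on the right. *)
Lemma sqrn_neq_double_sqr (a b : nat) : (0 < a)%N -> (b ^ 2 != 2 * a ^ 2)%N.
Proof.
move=> a0; apply/eqP => h.
have b0 : (0 < b)%N by rewrite lt0n; apply: contra_eqN h => /eqP->; lia.
have := congr1 (logn 2) h; rewrite lognM// ?expn_gt0 ?a0// !lognX.
rewrite (logn_prime 2 (isT : prime 2%N)); lia.
Qed.

(* Two arcs of length at most 1/2 joining the same points in both directions
   would have length exactly 1/2, which the irrationality of sqrt 2 forbids. *)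
Lemma log_arc_asym {R : realType} (q : R) (N u v : nat) : (0 < N)%N ->
  0 <= q -> q ^+ 2 <= 2 -> log_arc q N u v -> ~~ log_arc q N v u.
Proof.
move=> N0 q0 q2; wlog uv : u v / (u < v)%N => [hw|] auv.
  case: (ltngtP u v) (andP auv).1 => // vu _; first exact: hw.
  by apply/negP => avu; have := hw _ _ vu avu; rewrite auv.
apply/negP; move: auv; rewrite /log_arc uv ltnNge (ltnW uv)/= => /andP[_ h1] /andP[_ h2].
have a0 : 0 < (N + u)%:R :> R by rewrite ltr0n addn_gt0 N0.
have b0 : 0 < (N + v)%:R :> R by rewrite ltr0n addn_gt0 N0.
(* Squaring the two arc inequalities and using [q ^+ 2 <= 2] gives [b ^+ 2 <= 2 * a ^+ 2] and its
   converse. *)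
have hb : (N + v)%:R ^+ 2 == 2 * (N + u)%:R ^+ 2 :> R.
  move: h1 h2 a0 b0; set a : R := (N + u)%:R; set b : R := (N + v)%:R.
  rewrite mul1r => h1 h2 a0 b0.
  have := ler_wpM2r (sqr_ge0 a) q2; have := ler_wpM2r (sqr_ge0 b) q2.
  have : b ^+ 2 <= (q * a) ^+ 2 by rewrite lerXn2r ?nnegrE ?mulr_ge0 ?(ltW a0) ?(ltW b0).
  have : (2 * a) ^+ 2 <= (q * b) ^+ 2.
    by rewrite lerXn2r ?nnegrE ?mulr_ge0 ?(ltW a0) ?(ltW b0).
  by rewrite !exprMn eq_le => *; apply/andP; split; lra.
by move: hb; rewrite -!natrX -natrM eqr_nat; apply/negP/sqrn_neq_double_sqr; lia.
Qed.

(** * Counting arcs by the number of steps to the right *)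

(** Pairs are sorted by the cyclic difference [i]. The case [N = 0] is separate because the
    reindexing lives in the additive group ['I_N.+1]. *)
Lemma card_log_arc_shift {R : realType} (q : R) (N : nat) :
  #|[set p : 'I_N * 'I_N | log_arc q N p.1 p.2]%SET|
  = (\sum_(i < N) #|[set u : 'I_N | log_arc q N u ((u + i) %% N)]%SET|)%N.
Proof.
case: N => [|N].
  by rewrite big_ord0; apply: eq_card0 => -[[]].
transitivity (\sum_(u < N.+1) \sum_(v < N.+1 | log_arc q N.+1 u v) 1)%N.
  by rewrite pair_big_dep/= -sum1dep_card.
transitivity (\sum_(u < N.+1) \sum_(i < N.+1 | log_arc q N.+1 u ((u + i) %% N.+1)) 1)%N.
  by apply: eq_bigr => u _; rewrite (reindex_inj (addrI u)).
by rewrite (exchange_big_dep predT)//=; apply: eq_bigr => i _; rewrite sum1dep_card.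
Qed.

Lemma card_ord_interval (N a b : nat) : (b <= N)%N ->
  #|[set u : 'I_N | (a <= u < b)%N]%SET| = (b - a)%N.
Proof.
move=> bN; rewrite -sum1dep_card.
transitivity (\sum_(0 <= u < N | (a <= u < b)%N) 1)%N; first by rewrite big_mkord.
rewrite -(big_nat_widen 0 b N (fun u => (a <= u)%N))//.
by rewrite -(big_nat_widenl a 0 b xpredT)// sum_nat_const_nat muln1.
Qed.

(** The endpoint [u + i = N] is included: the target wraps to [N], and its factor 2 restores
    [2 N = N + (u + i)], so the inequality is the same as without wrapping. *)
Lemma log_arc_shift_below {R : realType} (q : R) (N u i : nat) :
  1 <= q <= 2 -> (0 < i < N)%N -> (u + i <= N)%N ->
  i%:R <= (N + u)%:R * (q - 1) -> log_arc q N u ((u + i) %% N).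
Proof.
move=> /andP[q1 q2] /andP[i0 iN] uiN; rewrite /log_arc.
case: (ltngtP (u + i) N) uiN => // [uiN _|uiN _].
  rewrite modn_small// (_ : (u != _))%N; last by lia.
  by rewrite (_ : (u < _)%N); [rewrite !natrD => h; lra | lia].
rewrite uiN modnn (_ : (u != _))%N; last by lia.
rewrite ltn0 addn0 /=.
have -> : N%:R = u%:R + i%:R :> R by rewrite -natrD uiN.
rewrite natrD; have -> : N%:R = u%:R + i%:R :> R by rewrite -natrD uiN.
by lra.
Qed.

Lemma log_arc_shift {R : realType} (q : R) (N u i : nat) :
  1 <= q <= 2 -> (0 < i < N)%N -> (u < N)%N ->
  i%:R <= N%:R * (q - 1) -> log_arc q N u ((u + i) %% N).
Proof.
move=> q12 /andP[i0 iN] uN h; have /andP[q1 q2] := q12.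
have uR : u%:R <= N%:R :> R by rewrite ler_nat ltnW.
have u0 : 0 <= u%:R :> R by [].
case: (leqP (u + i) N) => [uiN|uiN].
  (* Past [2N] the claim becomes [2 (u + i) <= q (N + u)]; with [i <= N (q - 1)] it reduces to
     [(2 - q) (N - u) >= 0]. *)
  by apply: log_arc_shift_below; rewrite ?i0// natrD; nra.
rewrite /log_arc -(subnK (ltnW uiN)) modnDr modn_small; last by lia.
rewrite (_ : (u != _))%N; last by lia.
rewrite ltnNge (_ : (_ <= u)%N)/=; last by lia.
by rewrite subnKC ?(ltnW uiN)// !natrD; nra.
Qed.

Lemma floor_nat {R : realType} (z : R) : 0 <= z ->
  exists k : nat, (Num.floor z)%:~R = k%:R :> R /\ k%:R <= z < k%:R + 1.
Proof.
move=> z0; exists `|Num.floor z|%N; have fz := floor_itv z.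
have e : Num.floor z = `|Num.floor z|%N by rewrite gez0_abs// floor_ge0.
by split; [rewrite {1}e | move: fz; rewrite intrD {1 2}e].
Qed.

(** The starting integers [a] with [i / (q - 1) < a <= 2 N - i] all work by [log_arc_shift_below];
    there are at least as many as the left-hand side. *)
Lemma card_log_arc_shift_ge {R : realType} (q : R) (N i : nat) :
  1 < q <= 2 -> (0 < i < N)%N -> N%:R * (q - 1) <= i%:R ->
  2 * N%:R - i%:R - i%:R / (q - 1)
  <= (#|[set u : 'I_N | log_arc q N u ((u + i) %% N)]%SET|)%:R.
Proof.
move=> /andP[q1 q2] /andP[i0 iN] h.
have C0 : 0 < q - 1 by rewrite subr_gt0.
have [k [_ /andP[k1 k2]]] := @floor_nat R (i%:R / (q - 1))
  (divr_ge0 (ler0n _ _) (ltW C0)).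
(* This makes the truncated subtraction [k.+1 - N] below exact. *)
have kN : (N <= k.+1)%N.
  rewrite -(ler_nat R) -[k.+1]addn1 natrD (le_trans _ (ltW k2))//.
  by rewrite ler_pdivlMr.
have : (2 * N - i - k <= #|[set u : 'I_N | log_arc q N u ((u + i) %% N)]%SET|)%N.
  rewrite (_ : (2 * N - i - k = (N - i).+1 - (k.+1 - N))%N); last by lia.
  rewrite -(@card_ord_interval N); last by lia.
  apply/subset_leq_card/fintype.subsetP => u; rewrite !inE => /andP[u1 u2].
  apply: log_arc_shift_below; [by rewrite (ltW q1)|by rewrite i0|lia|].
  rewrite -ler_pdivrMr// (le_trans (ltW k2))// natr1 ler_nat; lia.
rewrite -(ler_nat R); apply: le_trans.
have : (2 * N)%:R - i%:R - k%:R <= (2 * N - i - k)%:R :> R.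
  by rewrite !lerBlDr -!natrD ler_nat; lia.
by rewrite natrM; lra.
Qed.

(** Each shift [i <= kmin] contributes [N]; the larger ones are bounded by [card_log_arc_shift_ge].
    The factor 2 clears the denominator of [k (k + 1) / 2], and [q / (q - 1)] gathers
    [i + i / (q - 1)]. *)
Lemma card_log_arc_ge {R : realType} (q : R) (N kmin kmax : nat) :
  1 < q <= 2 -> (kmin <= kmax < N)%N ->
  kmin%:R <= N%:R * (q - 1) < kmin%:R + 1 ->
  4 * N%:R * kmax%:R - 2 * N%:R * kmin%:R
  - (kmax%:R * (kmax%:R + 1) - kmin%:R * (kmin%:R + 1)) * (q / (q - 1))
  <= 2 * (#|[set p : 'I_N * 'I_N | log_arc q N p.1 p.2]%SET|)%:R.
Proof.
move=> q12 /andP[kk kN] /andP[k1 k2]; have /andP[q1 q2] := q12.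
have C0 : 0 < q - 1 by rewrite subr_gt0.
pose f i := #|[set u : 'I_N | log_arc q N u ((u + i) %% N)]%SET|.
have fmin i : (0 < i <= kmin)%N -> f i = N.
  move=> /andP[i0 ik]; rewrite /f -[RHS]card_ord; apply: eq_card => u.
  rewrite !inE log_arc_shift ?(ltW q1)//; first by lia.
  by rewrite (le_trans _ k1)// ler_nat.
have fsum : (\sum_(1 <= i < kmax.+1) f i
             <= #|[set p : 'I_N * 'I_N | log_arc q N p.1 p.2]%SET|)%N.
  rewrite card_log_arc_shift -(big_mkord xpredT f).
  rewrite (@big_cat_nat _ _ _ 1 0)//=; last by lia.
  by rewrite [X in (_ <= _ + X)%N](@big_cat_nat _ _ _ kmax.+1)//= addnCA leq_addr.
move: fsum; rewrite -(ler_nat R) => fsum.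
suff : 4 * N%:R * kmax%:R - 2 * N%:R * kmin%:R
    - (kmax%:R * (kmax%:R + 1) - kmin%:R * (kmin%:R + 1)) * (q / (q - 1))
    <= 2 * (\sum_(1 <= i < kmax.+1) f i)%:R by move=> h; apply: (le_trans h); lra.
rewrite -(subnKC kk) in kN *; elim: (kmax - kmin)%N kN => [|d IH] kN.
  rewrite addn0 (@eq_big_nat _ _ _ 1 kmin.+1 f (fun=> N) fmin).
  rewrite sum_nat_const_nat subSS subn0 natrM.
  by rewrite subrr mul0r; lra.
rewrite addnS in kN *; rewrite big_nat_recr//= natrD mulrDr; have := IH (ltnW kN).
have h : N%:R * (q - 1) <= (kmin + d).+1%:R.
  by rewrite (le_trans (ltW k2))// natr1 ler_nat; lia.
have := @card_log_arc_shift_ge R q N (kmin + d).+1 q12 _ h.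
rewrite -/(f _) => /(_ ltac:(lia)).
set K : R := (kmin + d)%:R; rewrite -natr1 -/K.
have -> : q / (q - 1) = 1 + (q - 1)^-1 by field; rewrite gt_eqF.
set c := (q - 1)^-1 => H1 H2; lra.
Qed.

(** * The lower bound for the pair correlation function *)

(** Every arc gives two ordered pairs, one per direction. The bound on the square makes [log_arc]
    asymmetric, so no pair is counted twice, and [odd_index] carries these pairs injectively to
    pairs of indices. *)
Lemma pair_corr_log_arc_ge {R : realType} (N : nat) (alpha s : R) :
  (0 < N)%N -> (2 `^ (s / N%:R `^ alpha)) ^+ 2 <= 2 :> R ->
  2 * (#|[set p : 'I_N * 'I_N | log_arc (2 `^ (s / N%:R `^ alpha)) N p.1 p.2]%SET|)%:R
    / N%:R `^ (2 - alpha) <= pair_corr (@log_odd_seq R) N alpha s.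
Proof.
move=> N0; set d := s / _ => q2.
rewrite /pair_corr -/d ler_pM2r; last by rewrite invr_gt0 powR_gt0// ltr0n.
rewrite -natrM ler_nat.
set A := [set p : 'I_N * 'I_N | _]%SET; set D := [set p : 'I_N * 'I_N | _]%SET.
pose A' := [set p : 'I_N * 'I_N | log_arc (2 `^ d) N p.2 p.1]%SET.
have cA' : #|A'| = #|A|.
  have swapK : involutive (fun p : 'I_N * 'I_N => (p.2, p.1)) by case.
  rewrite -(card_imset _ (inv_inj swapK)); apply: eq_card => p.
  by rewrite -[p in LHS]swapK (mem_imset _ _ (inv_inj swapK)) !inE.
have dis : (A :&: A' = finset.set0)%SET.
  apply/setP => p; rewrite !inE; apply/negP => /andP[h].
  by apply/negP/log_arc_asym; rewrite ?powR_ge0.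
pose sigma (u : 'I_N) : 'I_N :=
  Ordinal (@odd_index_ltn N (N + u) ltac:(have := ltn_ord u; lia)).
have sigma_inj : injective sigma.
  move=> u v /(congr1 val)/= /(@odd_index_inj N) h; apply: val_inj => /=.
  by have := h N0; have := ltn_ord u; have := ltn_ord v; lia.
pose f (p : 'I_N * 'I_N) := (sigma p.1, sigma p.2).
have f_inj : injective f.
  move=> [u v] [u' v'] e.
  by rewrite (sigma_inj u u' (congr1 fst e)) (sigma_inj v v' (congr1 snd e)).
rewrite mul2n -addnn -{2}cA' -cardsUI dis cards0 addn0 -(card_imset _ f_inj).
apply/subset_leq_card/fintype.subsetP => _ /imsetP[[u v] h ->].
move: h; rewrite !inE (inj_eq sigma_inj) -!(inj_eq val_inj)/=.
case/orP => h; rewrite ?(andP h).1.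
  by have [-> _] := log_arc_dist _ _ _ _ (ltn_ord u) (ltn_ord v) h.
have [_ ->] := log_arc_dist _ _ _ _ (ltn_ord v) (ltn_ord u) h.
by rewrite eq_sym (andP h).1.
Qed.

Lemma C_ge0 {R : realType} (N : nat) (s alpha : R) : 0 <= s -> 0 <= C_ N s alpha.
Proof.
move=> s0; rewrite subr_ge0 -[leLHS](@powRr0 R 2) ler_powR ?ler1n//.
by rewrite divr_ge0 ?powR_ge0.
Qed.

Lemma K_min_bounds {R : realType} (N : nat) (s alpha : R) :
  K_min N s alpha <= N%:R * C_ N s alpha < K_min N s alpha + 1.
Proof. by rewrite /K_min; have := floor_itv (N%:R * C_ N s alpha); rewrite intrD. Qed.

Lemma K_max_bounds {R : realType} (N : nat) (s alpha : R) :
  K_max N s alpha <= 2 * N%:R * C_ N s alpha / (1 + C_ N s alpha)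
    < K_max N s alpha + 1.
Proof.
rewrite /K_max.
have := floor_itv (2 * N%:R * C_ N s alpha / (1 + C_ N s alpha)).
by rewrite intrD.
Qed.

Lemma powR_nat_1B {R : realType} (N : nat) (alpha x : R) : (0 < N)%N ->
  x / N%:R `^ (1 - alpha) = N%:R * x / N%:R `^ (2 - alpha).
Proof.
move=> N0; have N0' : N%:R != 0 :> R by rewrite pnatr_eq0 -lt0n.
have -> : N%:R `^ (2 - alpha) = N%:R * N%:R `^ (1 - alpha) :> R.
  rewrite -{2}(powRr1 (ler0n R N)) -powRD ?N0' ?implybT//.
  by congr (_ `^ _); ring.
field.
by rewrite N0' gt_eqF ?powR_gt0 ?ltr0n.
Qed.

(** Both floors vanish, hence so does [K_tilde], and it multiplies the fraction whose denominator is
    0. *)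
Lemma g_bound_C0 {R : realType} (N : nat) (s alpha : R) :
  C_ N s alpha = 0 -> g_bound N s alpha = - (2 / N%:R `^ (2 - alpha)).
Proof.
move=> C0; rewrite /g_bound /K_tilde /K_max /K_min C0 !(mulr0, mul0r) floor0.
by ring.
Qed.

Lemma g_bound_le_pair_corr {R : realType} (alpha : R) (N : nat) (s : R) :
  (1 <= N)%N -> 0 <= s -> s / N%:R `^ alpha <= 1 / 2 ->
  g_bound N s alpha <= pair_corr (@log_odd_seq R) N alpha s.
Proof.
move=> N0 s0 sN.
have NX : 0 < N%:R `^ (2 - alpha) :> R by rewrite powR_gt0// ltr0n.
have NR : 1 <= N%:R :> R by rewrite ler1n.
have Cge := C_ge0 N s alpha s0.
have [C0|Cn0] := eqVneq (C_ N s alpha) 0.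
  apply: (@le_trans _ _ 0); last by rewrite divr_ge0// ltW.
  by rewrite g_bound_C0// oppr_le0 divr_ge0// ltW.
have Cgt : 0 < C_ N s alpha by rewrite lt_def Cn0.
have q2 : (2 `^ (s / N%:R `^ alpha)) ^+ 2 <= 2 :> R.
  rewrite -powR_mulrn ?powR_ge0// -powRrM -[leRHS]powRr1// ler_powR ?ler1n//; lra.
apply: le_trans (pair_corr_log_arc_ge N alpha s N0 q2).
have eC : 2 `^ (s / N%:R `^ alpha) = 1 + C_ N s alpha by rewrite /C_; ring.
rewrite eC in q2 *; set c := C_ N s alpha in Cge Cn0 Cgt q2 *.
(* From [(1 + c) ^+ 2 <= 2]. In particular [c < 1], which yields both [kmin <= kmax] and
   [kmax < N]. *)
have chalf : c <= 1 / 2 by nra.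
have c1 : 0 < 1 + c by lra.
have Kmin0 : 0 <= N%:R * c by nra.
have Kmax0 : 0 <= 2 * N%:R * c / (1 + c)
  by rewrite divr_ge0 ?(ltW c1)// -mulrA mulr_ge0.
have [kmin [emin bmin]] := floor_nat _ Kmin0.
have [kmax [emax bmax]] := floor_nat _ Kmax0.
have := @card_log_arc_ge R (1 + c) N kmin kmax.
have -> : 1 + c - 1 = c by ring.
move=> /(_ _ _ bmin) H.
have {}H := H ltac:(apply/andP; split; lra).
have kk : (kmin <= kmax < N)%N.
  apply/andP; split.
    have : kmin%:R < (kmax.+1)%:R :> R; last by rewrite ltr_nat.
    rewrite -natr1 (le_lt_trans _ (andP bmax).2)// (le_trans (andP bmin).1)//.
    by rewrite ler_pdivlMr// -[leRHS]mulrA [leRHS]mulrC ler_wpM2l//; lra.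
  rewrite -(ltr_nat R) (le_lt_trans (andP bmax).1)// ltr_pdivrMr//.
  by rewrite -mulrA mulrCA ltr_pM2l ?ltr0n//; lra.
have {}H := H kk.
have Emin : K_min N s alpha = kmin%:R by exact: emin.
have Emax : K_max N s alpha = kmax%:R by exact: emax.
rewrite /g_bound /K_tilde Emin Emax -/c.
rewrite (powR_nat_1B N alpha kmin%:R N0) (powR_nat_1B N alpha kmax%:R N0).
rewrite ler_pdivlMr//; apply: le_trans H.
move: (N%:R `^ (2 - alpha)) NX => Y Y0; rewrite [leLHS](_ : _ =
  4 * N%:R * kmax%:R - 2 * N%:R * kmin%:R
  - (kmax%:R * (kmax%:R + 1) - kmin%:R * (kmin%:R + 1)) * ((1 + c) / c) - 2).
  by rewrite lerBlDr lerDl.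
by field; rewrite Cn0 gt_eqF.
Qed.

(* 32/47 exceeds 100/147, so that 3 (49/50) ln 2 > 2. *)
Lemma ln2_gt {R : realType} : 32 / 47 < ln 2 :> R.
Proof.
have h : ln (46 / 47 : R) <= - (1 / 47).
  have -> : 46 / 47 = 1 + - (1 / 47) :> R by lra.
  by apply: le_ln1Dx; lra.
(* Five squarings, each rounded down. Taking logarithms, [- ln 2 < 32 ln (46 / 47) <= - 32 / 47]. *)
have h2 : 2^-1 < (46 / 47) ^+ 32 :> R.
  have -> : 32%N = (2 * 2 * 2 * 2 * 2)%N by [].
  rewrite !exprM.
  have sq (x y z : R) : 0 <= x -> z <= x ^+ 2 -> x <= y -> z <= y ^+ 2.
    by move=> x0 zx xy; rewrite (le_trans zx)// lerXn2r ?nnegrE// (le_trans x0).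
  have e1 : 9578 / 10000 <= (46 / 47) ^+ 2 :> R by rewrite expr2; lra.
  have e2 : 9173 / 10000 <= (46 / 47) ^+ 2 ^+ 2 :> R.
    by apply: sq e1; rewrite ?expr2; lra.
  have e3 : 8414 / 10000 <= (46 / 47) ^+ 2 ^+ 2 ^+ 2 :> R.
    by apply: sq e2; rewrite ?expr2; lra.
  have e4 : 7079 / 10000 <= (46 / 47) ^+ 2 ^+ 2 ^+ 2 ^+ 2 :> R.
    by apply: sq e3; rewrite ?expr2; lra.
  have e5 : 501 / 1000 <= (46 / 47) ^+ 2 ^+ 2 ^+ 2 ^+ 2 ^+ 2 :> R.
    by apply: sq e4; rewrite ?expr2; lra.
  by apply: lt_le_trans e5; lra.
have h0 : 0 < 46 / 47 :> R by lra.
have : ln 2^-1 < ln ((46 / 47) ^+ 32) :> R by rewrite ltr_ln ?posrE ?exprn_gt0 ?invr_gt0.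
rewrite lnV ?posrE// lnXn// -mulr_natl; lra.
Qed.

(** * Asymptotics of [C], [K_min], [K_max] and [g] *)

Lemma powR_cvgy {R : realType} (a : R) : 0 < a -> N%:R `^ a @[N --> \oo] --> +oo.
Proof.
move=> a0; apply/cvgryPge => A; near=> N.
have hN : Num.max A 0 `^ a^-1 <= N%:R by near: N; exact: nbhs_infty_ger.
have m0 : 0 <= Num.max A 0 by rewrite le_max lexx orbT.
apply: (@le_trans _ _ (Num.max A 0)); first by rewrite le_max lexx.
rewrite -[leLHS]powRr1// -[X in _ `^ X <= _](mulVf (lt0r_neq0 a0)) powRrM.
by rewrite ge0_ler_powR ?nnegrE ?powR_ge0// ltW.
Unshelve. all: end_near. Qed.

Lemma powR_inv_cvg0 {R : realType} (a : R) : 0 < a ->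
  (N%:R `^ a)^-1 @[N --> \oo] --> (0 : R).
Proof.
move=> a0; apply/gtr0_cvgV0; last exact: powR_cvgy.
near=> N; rewrite powR_gt0// ltr0n; near: N; exact: nbhs_infty_gt.
Unshelve. all: end_near. Qed.

Lemma C_cvg0 {R : realType} (s alpha : R) : 0 < alpha ->
  C_ N s alpha @[N --> \oo] --> 0.
Proof.
move=> a0; rewrite /C_ -[X in _ --> X](subrr 1).
apply: cvgB; last exact: cvg_cst.
have h : s / N%:R `^ alpha * ln 2 @[N --> \oo] --> (0 : R).
  rewrite (_ : 0 = s * 0 * ln 2); last by rewrite mulr0 mul0r.
  by apply: cvgMr_tmp; apply: cvgMl_tmp; exact: powR_inv_cvg0.
have e N : 2 `^ (s / N%:R `^ alpha) = expR (s / N%:R `^ alpha * ln 2) :> R.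
  by rewrite {1}/powR pnatr_eq0.
have : expR (s / N%:R `^ alpha * ln 2) @[N --> \oo] --> expR (0 : R).
  by apply: continuous_cvg => //; exact: continuous_expR.
by rewrite expR0; under eq_fun do rewrite -e.
Qed.

(** With [t = s ln 2 / N^alpha] one has [C = e^t - 1], and the claim is [t <= e^t - 1 <= t e^t]; the
    second inequality is [1 - t <= e^(-t)] multiplied by [e^t]. *)
Lemma C_mul_powR_bounds {R : realType} (N : nat) (s alpha : R) :
  (0 < N)%N -> 0 <= s ->
  s * ln 2 <= C_ N s alpha * N%:R `^ alpha <= s * ln 2 * (1 + C_ N s alpha).
Proof.
move=> N0 s0; have X0 : 0 < N%:R `^ alpha :> R by rewrite powR_gt0// ltr0n.
have -> : C_ N s alpha = expR (s * ln 2 / N%:R `^ alpha) - 1.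
  by rewrite /C_ /powR (_ : (2 == 0 :> R) = false) ?pnatr_eq0// mulrAC.
set X := _ `^ _ in X0 *; set t := s * ln 2 / X.
have -> : s * ln 2 = t * X by rewrite mulfVK ?gt_eqF.
have h1 := expR_ge1Dx t; have h2 := expR_ge1Dx (- t).
have e0 := expR_gt0 t.
have : expR t * (1 - t) <= 1.
  by rewrite -[leRHS](@expRxMexpNx_1 _ t) ler_wpM2l// ltW.
move=> h3; rewrite ler_pM2r// mulrAC ler_pM2r//; apply/andP; split; lra.
Qed.

Lemma C_mul_powR_cvg {R : realType} (s alpha : R) : 0 < alpha -> 0 <= s ->
  C_ N s alpha * N%:R `^ alpha @[N --> \oo] --> s * ln 2.
Proof.
move=> a0 s0; apply: (@squeeze_cvgr _ _ _ _ (fun=> s * ln 2)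
  (fun N => s * ln 2 * (1 + C_ N s alpha))).
- near=> N; apply: C_mul_powR_bounds => //; near: N; exact: nbhs_infty_gt.
- exact: cvg_cst.
- rewrite -[X in _ --> X]mulr1; apply: cvgMl_tmp.
  rewrite -[X in _ --> X]addr0; apply: cvgD; [exact: cvg_cst|exact: C_cvg0].
Unshelve. all: end_near. Qed.

Lemma natr_powR_split {R : realType} (N : nat) (alpha : R) : (0 < N)%N ->
  N%:R = N%:R `^ alpha * N%:R `^ (1 - alpha) :> R.
Proof.
move=> N0; have N0' : N%:R != 0 :> R by rewrite pnatr_eq0 -lt0n.
by rewrite -powRD ?N0' ?implybT// addrC subrK powRr1.
Qed.

Lemma natr_powR_2B {R : realType} (N : nat) (alpha : R) : (0 < N)%N ->
  N%:R `^ (2 - alpha) = N%:R `^ alpha * N%:R `^ (1 - alpha) * N%:R `^ (1 - alpha) :> R.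
Proof.
move=> N0; have N0' : N%:R != 0 :> R by rewrite pnatr_eq0 -lt0n.
by rewrite -!powRD ?N0' ?implybT//; congr (_ `^ _); ring.
Qed.

(** After division by [N^(1-alpha)], the floor costs at most [N^(alpha-1)]. *)
Lemma K_min_scaled {R : realType} (N : nat) (s alpha : R) : (0 < N)%N ->
  C_ N s alpha * N%:R `^ alpha - (N%:R `^ (1 - alpha))^-1
  <= K_min N s alpha / N%:R `^ (1 - alpha) <= C_ N s alpha * N%:R `^ alpha.
Proof.
move=> N0; have Y0 : 0 < N%:R `^ (1 - alpha) :> R by rewrite powR_gt0// ltr0n.
have := K_min_bounds N s alpha.
rewrite {1 2}(natr_powR_split N alpha N0).
move: (N%:R `^ (1 - alpha)) Y0 (N%:R `^ alpha) (C_ _ _ _) (K_min _ _ _) => Y Y0 X c k.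
move=> /andP[h1 h2]; rewrite ler_pdivrMr// ler_pdivlMr// mulrBl mulVf ?gt_eqF//.
by apply/andP; split; lra.
Qed.

Lemma K_max_scaled {R : realType} (N : nat) (s alpha : R) : (0 < N)%N ->
  2 * (C_ N s alpha * N%:R `^ alpha) / (1 + C_ N s alpha) - (N%:R `^ (1 - alpha))^-1
  <= K_max N s alpha / N%:R `^ (1 - alpha)
  <= 2 * (C_ N s alpha * N%:R `^ alpha) / (1 + C_ N s alpha).
Proof.
move=> N0; have Y0 : 0 < N%:R `^ (1 - alpha) :> R by rewrite powR_gt0// ltr0n.
have := K_max_bounds N s alpha.
rewrite {1 2}(natr_powR_split N alpha N0).
move: (N%:R `^ (1 - alpha)) Y0 (N%:R `^ alpha) (C_ _ _ _) (K_max _ _ _) => Y Y0 X c k.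
move=> /andP[h1 h2]; rewrite ler_pdivrMr// ler_pdivlMr// mulrBl mulVf ?gt_eqF//.
by apply/andP; split; lra.
Qed.

(** In this form every factor converges when [0 < alpha < 1], whereas [(C + 1) / C] alone diverges
    for [s > 0]. *)
Lemma g_boundE {R : realType} (N : nat) (s alpha : R) :
  (0 < N)%N -> C_ N s alpha != 0 ->
  let Y := N%:R `^ (1 - alpha) in
  let k := K_max N s alpha / Y in let m := K_min N s alpha / Y in
  g_bound N s alpha = 4 * k - 2 * m - 2 * (N%:R `^ (2 - alpha))^-1
   - (k * (k + Y^-1) - m * (m + Y^-1))
     * ((1 + C_ N s alpha) / (C_ N s alpha * N%:R `^ alpha)).
Proof.
move=> N0 c0 Y k m; rewrite /g_bound /K_tilde /k /m natr_powR_2B// -/Y.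
have Y0 : Y != 0 by rewrite gt_eqF// powR_gt0// ltr0n.
have X0 : N%:R `^ alpha != 0 :> R by rewrite gt_eqF// powR_gt0// ltr0n.
by field; rewrite X0 Y0 c0.
Qed.

Lemma C_gt0 {R : realType} (N : nat) (s alpha : R) :
  (0 < N)%N -> 0 < s -> 0 < C_ N s alpha.
Proof.
move=> N0 s0; have l2 : 0 < ln 2 :> R by rewrite ln_gt0// ltr1n.
have /andP[h _] := C_mul_powR_bounds N s alpha N0 (ltW s0).
have X0 : 0 < N%:R `^ alpha :> R by rewrite powR_gt0// ltr0n.
by rewrite -(pmulr_lgt0 _ X0) (lt_le_trans _ h)// mulr_gt0.
Qed.

Lemma ln4 {R : realType} : ln 4 = 2 * ln 2 :> R.
Proof.
have -> : 4 = 2 ^+ 2 :> R by rewrite expr2; lra.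
by rewrite lnXn// mulr_natl.
Qed.

(** Put [sg = s ln 2]. As [alpha > 0], [C] tends to 0; as [alpha < 1], the floor errors vanish. So
    [m] and [k] tend to [sg] and [2 sg], and the limit is [8 sg - 2 sg - 3 sg = 3 sg]. *)
Lemma g_bound_cvg {R : realType} (alpha s : R) : 0 < alpha < 1 -> 0 <= s ->
  (fun N : nat => g_bound N s alpha) @ \oo --> 2 * s * (3 / 4 * ln 4).
Proof.
move=> /andP[a0 a1]; have a2 : 0 < 2 - alpha by lra.
have a1' : 0 < 1 - alpha by lra.
rewrite le_eqVlt => /orP[/eqP<-|s0].
  rewrite (_ : 2 * 0 * (3 / 4 * ln 4) = - (2 * 0)); last by ring.
  under eq_fun do rewrite g_bound_C0 ?/C_ ?mul0r ?powRr0 ?subrr//.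
  by apply: cvgN; apply: cvgMl_tmp; exact: powR_inv_cvg0.
have l2 : 0 < ln 2 :> R by rewrite ln_gt0// ltr1n.
pose sg := s * ln 2; have sg0 : sg != 0 by rewrite gt_eqF ?mulr_gt0.
have cC := C_cvg0 s alpha a0.
have cc := C_mul_powR_cvg s alpha a0 (ltW s0).
have cY := powR_inv_cvg0 (1 - alpha) a1'.
have c1C : 1 + C_ N s alpha @[N --> \oo] --> (1 : R).
  by rewrite -[X in _ --> X]addr0; apply: cvgD => //; exact: cvg_cst.
have cm : K_min N s alpha / N%:R `^ (1 - alpha) @[N --> \oo] --> sg.
  apply: (@squeeze_cvgr _ _ _ _
    (fun N => C_ N s alpha * N%:R `^ alpha - (N%:R `^ (1 - alpha))^-1)
    (fun N => C_ N s alpha * N%:R `^ alpha)) => //.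
    near=> N; apply: K_min_scaled; near: N; exact: nbhs_infty_gt.
  by rewrite -[X in _ --> X]subr0; apply: cvgB.
have ce : 2 * (C_ N s alpha * N%:R `^ alpha) / (1 + C_ N s alpha) @[N --> \oo] --> 2 * sg.
  rewrite -[X in _ --> X]mulr1 -[X in _ * X]invr1; apply: cvgM; first exact: cvgMl_tmp.
  by apply: cvgV => //; exact: oner_neq0.
have ck : K_max N s alpha / N%:R `^ (1 - alpha) @[N --> \oo] --> 2 * sg.
  apply: (@squeeze_cvgr _ _ _ _
    (fun N => 2 * (C_ N s alpha * N%:R `^ alpha) / (1 + C_ N s alpha)
              - (N%:R `^ (1 - alpha))^-1)
    (fun N => 2 * (C_ N s alpha * N%:R `^ alpha) / (1 + C_ N s alpha))) => //.
    near=> N; apply: K_max_scaled; near: N; exact: nbhs_infty_gt.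
  by rewrite -[X in _ --> X]subr0; apply: cvgB.
have -> : 2 * s * (3 / 4 * ln 4) = 4 * (2 * sg) - 2 * sg - 2 * 0
    - (2 * sg * (2 * sg + 0) - sg * (sg + 0)) * (1 / sg).
  by rewrite ln4 /sg; field; rewrite !lt0r_neq0.
apply: cvg_trans.
  apply: near_eq_cvg; near=> N; symmetry; apply: g_boundE.
    by near: N; exact: nbhs_infty_gt.
  by rewrite gt_eqF// C_gt0//; near: N; exact: nbhs_infty_gt.
apply: cvgB; last first.
  apply: cvgM; last by apply: cvgM => //; exact: cvgV.
  by apply: cvgB; apply: cvgM => //; apply: cvgD.
apply: cvgB; last by apply: cvgMl_tmp; exact: powR_inv_cvg0.
by apply: cvgB; exact: cvgMl_tmp.
Unshelve. all: end_near. Qed.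

(** A bound for each [N], which also serves [alpha = 0] and [alpha = 1], outside the range of
    [g_bound_cvg]. *)
Lemma g_bound_ge {R : realType} (N : nat) (s alpha : R) : (0 < N)%N -> 0 < s ->
  C_ N s alpha <= 1 ->
  3 * (s * ln 2) * (1 - C_ N s alpha) - 10 / N%:R `^ (1 - alpha)
  <= g_bound N s alpha.
Proof.
move=> N0 s0 C1; have Cp := C_gt0 N s alpha N0 s0.
have X0 : 0 < N%:R `^ alpha :> R by rewrite powR_gt0// ltr0n.
have Y0 : 0 < N%:R `^ (1 - alpha) :> R by rewrite powR_gt0// ltr0n.
rewrite g_boundE ?lt0r_neq0//.
have [hk hm] := (K_max_scaled N s alpha N0, K_min_scaled N s alpha N0).
have /andP[hc _] := C_mul_powR_bounds N s alpha N0 (ltW s0).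
have : 0 <= K_max N s alpha / N%:R `^ (1 - alpha).
  rewrite divr_ge0 ?(ltW Y0)// ler0z floor_ge0 divr_ge0 ?(addr_ge0 ler01 (ltW Cp))//.
  by rewrite !mulr_ge0 ?(ltW Cp).
have : 0 <= K_min N s alpha / N%:R `^ (1 - alpha).
  by rewrite divr_ge0 ?(ltW Y0)// ler0z floor_ge0 mulr_ge0 ?(ltW Cp).
have : (N%:R `^ (2 - alpha))^-1 <= (N%:R `^ (1 - alpha))^-1 :> R.
  by rewrite lef_pV2 ?posrE ?powR_gt0 ?ltr0n// ler_powR ?ler1n//; lra.
have : 0 < C_ N s alpha * N%:R `^ alpha by rewrite mulr_gt0.
move: (N%:R `^ (2 - alpha))^-1 hk hm hc => z.
have : 0 < (N%:R `^ (1 - alpha))^-1 :> R by rewrite invr_gt0.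
move: (K_max N s alpha / _) (K_min N s alpha / _) => k m.
move: (C_ N s alpha * _) (_ `^ (1 - alpha))^-1 => c y.
move: (C_ N s alpha) Cp C1 => C Cp C1.
move=> y0 /andP[k1 k2] /andP[m1 m2] sc c0 zy m0 k0.
set e := 2 * c / (1 + C) in k1 k2.
have ee : e * (1 + C) = 2 * c by rewrite divfK// lt0r_neq0//; lra.
have e0 : 0 < e by rewrite divr_gt0//; lra.
have kk : k * (k + y) * ((1 + C) / c) <= 2 * (e + y).
  rewrite mulrA ler_pdivrMr//.
  have : k * (k + y) <= e * (e + y) by rewrite ler_pM//; lra.
  move=> h; apply: (@le_trans _ _ (e * (e + y) * (1 + C))); first by rewrite ler_pM2r//; lra.
  by rewrite mulrAC ee; lra.
have mm : (c - y) * (1 + C) <= m * (m + y) * ((1 + C) / c).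
  rewrite mulrA ler_pdivlMr// mulrAC ler_pM2r//; last by lra.
  (* If [c <= y] the left side is nonpositive; otherwise [m >= c - y > 0] and [m + y >= c]. *)
  have [cy|cy] := leP (c - y) 0.
    apply: (@le_trans _ _ 0); last by rewrite mulr_ge0//; lra.
    by rewrite pmulr_lle0.
  by rewrite ler_pM//; lra.
have ce : 2 * c * (1 - C) <= e.
  rewrite ler_pdivlMr//; last by lra.
  rewrite -[leLHS]mulrA ler_piMr//; first by lra.
  by have := sqr_ge0 C; rewrite expr2; lra.
have yC : y * C <= y by rewrite ler_piMr// ltW.
have scC : 3 * (s * ln 2) * (1 - C) <= 3 * c * (1 - C).
  by rewrite ler_wpM2r//; lra.
(* The 10 collects 4 from [4 k], 2 from [kk], 2 from [z <= y], and 2 from [mm] together with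
   [yC]. *)
lra.
Qed.

(** * Failure of weak correlations *)

Lemma weak_correlations_le {R : realType} (s alpha b : R) : 0 <= s ->
  weak_correlations (@log_odd_seq R) alpha ->
  (\forall N \near \oo, (s / N%:R `^ alpha <= 1 / 2)%R) ->
  (\forall N \near \oo, (b <= g_bound N s alpha)%R) -> b <= 2 * s.
Proof.
move=> s0 wc h1 h2; apply: (cvgr_to_ge (wc s s0)); near=> N.
apply: (@le_trans _ _ (g_bound N s alpha)); first by near: N.
apply: g_bound_le_pair_corr => //; first by near: N; exact: nbhs_infty_gt.
by near: N.
Unshelve. all: end_near. Qed.

Lemma not_weak_correlations_pos {R : realType} (alpha : R) : 0 < alpha <= 1 ->
  ~ weak_correlations (@log_odd_seq R) alpha.
Proof.
move=> /andP[a0 a1] wc; have l2 := @ln2_gt R.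
pose d := 3 * ln 2 * (49 / 50) - 2 : R.
have d0 : 0 < d by rewrite /d; lra.
(* Chosen so that [s * d = 11], while weak correlations would force [s * d <= 10]. *)
pose s := 11 / d; have s0 : 0 < s by rewrite divr_gt0.
have : 3 * (s * ln 2) * (49 / 50) - 10 <= 2 * s.
  apply: weak_correlations_le wc _ _; first exact: ltW.
    apply: (@cvgr_le _ _ _ _ _ 0); last by lra.
    rewrite -(mulr0 s); apply: cvgMl_tmp; exact: powR_inv_cvg0.
  near=> N; have N0 : (0 < N)%N by near: N; exact: nbhs_infty_gt.
  have C50 : C_ N s alpha <= 1 / 50.
    by near: N; apply: (cvgr_le _ (C_cvg0 s alpha a0)); lra.
  apply: le_trans (g_bound_ge N s alpha N0 s0 _); last by lra.
  have Y1 : 1 <= N%:R `^ (1 - alpha) :> R.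
    by rewrite -[leLHS](@powRr0 R N%:R) ler_powR ?ler1n//; lra.
  have l0 : 0 < s * ln 2 by rewrite mulr_gt0//; lra.
  apply: lerB; first by rewrite ler_pM2l//; lra.
  by rewrite ler_pdivrMr ?(lt_le_trans _ Y1)// ler_peMr.
have : s * d = 11 by rewrite /s divfK ?lt0r_neq0.
rewrite /d; lra.
Unshelve. all: end_near. Qed.

Lemma not_weak_correlations_0 {R : realType} :
  ~ weak_correlations (@log_odd_seq R) 0.
Proof.
move=> wc; have l2 := @ln2_gt R; have l20 : 0 < ln 2 :> R by lra.
have la : 0 < ln (1 + 1 / 50) :> R by rewrite ln_gt0//; lra.
have lb : ln (1 + 1 / 50) <= 1 / 50 :> R by apply: le_ln1Dx; lra.
(* For [alpha = 0], [C = 2^s - 1] does not depend on [N]; this [s] makes it equal to [1 / 50]. *)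
pose s : R := ln (1 + 1 / 50) / ln 2.
have s0 : 0 < s by rewrite divr_gt0.
have sl : s * ln 2 = ln (1 + 1 / 50) by rewrite divfK ?lt0r_neq0.
have C50 (N : nat) : C_ N s 0 = 1 / 50.
  rewrite /C_ powRr0 divr1 /powR pnatr_eq0/= sl lnK ?posrE; lra.
have : 3 * (s * ln 2) * (49 / 50) <= 2 * s; last first.
  have : 0 < s * (3 * ln 2 * (49 / 50) - 2) by rewrite mulr_gt0//; lra.
  lra.
(* The error [10 / N] of [g_bound_ge] is eventually below any [eps]. *)
apply/ler_addgt0Pr => eps eps0; rewrite -lerBlDr.
apply: weak_correlations_le wc _ _; first exact: ltW.
  near=> N; rewrite powRr0 divr1 ler_pdivrMr//; lra.
near=> N; have N0 : (0 < N)%N by near: N; exact: nbhs_infty_gt.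
apply: le_trans (g_bound_ge N s 0 N0 s0 _); rewrite C50; last by lra.
rewrite subr0 powRr1//.
have NR : 0 < N%:R :> R by rewrite ltr0n.
apply: lerB; first by lra.
rewrite ler_pdivrMr// mulrC -ler_pdivrMr//; near: N; exact: nbhs_infty_ger.
Unshelve. all: end_near. Qed.

Theorem mainTheorem5 (R : realType) :
  [/\ forall (alpha : R) (N : nat) (s : R),
        0 <= alpha <= 1 -> (1 <= N)%N -> 0 <= s ->
        s / N%:R `^ alpha <= 1 / 2 ->
        g_bound N s alpha <= pair_corr (@log_odd_seq R) N alpha s,
      forall alpha s : R,
        0 < alpha < 1 -> 0 <= s ->
        (fun N : nat => g_bound N s alpha) @ \oo --> 2 * s * (3 / 4 * ln 4)
    & forall alpha : R,
        0 <= alpha <= 1 -> ~ weak_correlations (@log_odd_seq R) alpha].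
Proof.
split.
- by move=> alpha N s _; exact: g_bound_le_pair_corr.
- exact: g_bound_cvg.
- move=> alpha /andP[]; rewrite le_eqVlt => /orP[/eqP<- _|a0 a1].
    exact: not_weak_correlations_0.
  by apply: not_weak_correlations_pos; rewrite a0.
Qed.
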